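(* Let $\mathbb{X},\mathbb{Y}$ be Euclidean spaces, $\Phi:\mathbb{X}\to\mathbb{Y}$ a linear operator, $y_0\in\mathbb{Y}$, $R:\mathbb{X}\to\mathbb{R}$ a continuous convex piecewise linear-quadratic function, and let $x_0$ be a solution of the problem $\min_{x\in\mathbb{X}} R(x)$ subject to $\Phi x=y_0$. Then stable recovery occurs at $x_0$ if and only if $x_0$ is a unique (equivalently, strong) optimal solution of this problem.
   Context: Euclidean spaces are finite-dimensional real inner product spaces; $\|\cdot\|$ is the associated norm. A function $R:\mathbb{X}\to\mathbb{R}$ is convex piecewise linear-quadratic if it is convex and its domain (here $\mathbb{X}$) can be written as a union of finitely many polyhedral sets, on each of which $R$ is represented as $\frac12\langle Ax,x\rangle+\langle b,x\rangle+c$ with some positive semi-definite linear operator $A:\mathbb{X}\to\mathbb{X}$, $b\in\mathbb{X}$, $c\in\mathbb{R}$. Strong optimal solution of the problem: $\Phi x_0=y_0$ and there are $\kappa,\varepsilon>0$ with $R(x)-R(x_0)\ge\frac{\kappa}{2}\|x-x_0\|^2$ for all $x$ with $\Phi x=y_0$ and $\|x-x_0\|\le\varepsilon$. Stable recovery: for $y\in\mathbb{Y}$ and $\mu>0$ let $P(y,\mu)$ be the problem $\min_{x\in\mathbb{X}}\frac12\|\Phi x-y\|^2+\mu R(x)$. Stable recovery occurs at $x_0$ if for every constant $c>0$ there exist $K>0$ and $\bar\delta>0$ such that for all $\delta\in(0,\bar\delta)$, all $y$ with $\|y-y_0\|\le\delta$, and $\mu=c\delta$, every optimal solution $x(y,\mu)$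 of $P(y,\mu)$ satisfies $\|x(y,\mu)-x_0\|\le K\delta$. *)

(* Defs.v *)
From HB Require Import structures.
From mathcomp Require Import all_boot all_order all_algebra.
From mathcomp Require Import boolp classical_sets reals convex.

Set Implicit Arguments.
Unset Strict Implicit.
Unset Printing Implicit Defensive.

Import Order.TTheory GRing.Theory Num.Theory.
Local Open Scope classical_set_scope.
Local Open Scope ring_scope.

(* A Euclidean space is a finite-dimensional vector space [X : vectType K] over
   the real numbers [K : realType] together with an inner product
   [ip : {dot X for idfun}] (bilinear, symmetric and positive definite). *)

Definition enorm (K : realType) (X : vectType K) (ip : {dot X for idfun})
  (x : X) : K := Num.sqrt (ip x x).

(* A bare [vectType] carries no topology; this is continuity for the topology
   of [enorm]. *)
Definition econtinuous (K : realType) (X : vectType K)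
  (ip : {dot X for idfun}) (R : X -> K) : Prop :=
  forall (x : X) (eps : K), 0 < eps ->
    exists2 eta : K, 0 < eta &
      forall z : X, enorm ip (z - x) < eta -> `|R z - R x| < eps.

Definition polyhedral (K : realType) (X : vectType K)
  (ip : {dot X for idfun}) (P : set X) : Prop :=
  exists (m : nat) (a : 'I_m -> X) (b : 'I_m -> K),
    P = [set x | forall i : 'I_m, ip (a i) x <= b i].

(* As usual for operators on real spaces, positive semi-definiteness includes
   self-adjointness. *)
Definition psd_operator (K : realType) (X : vectType K)
  (ip : {dot X for idfun}) (A : 'End(X)) : Prop :=
  (forall u v : X, ip (A u) v = ip u (A v)) /\ (forall u : X, 0 <= ip (A u) u).

Definition convex_plq (K : realType) (X : vectType K)
  (ip : {dot X for idfun}) (R : X -> K) : Prop :=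
  convex_function [set: convex_lmodType X] R /\
  exists (k : nat) (P : 'I_k -> set X)
         (A : 'I_k -> 'End(X)) (b : 'I_k -> X) (c : 'I_k -> K),
    [/\ forall i, polyhedral ip (P i),
        \bigcup_i P i = [set: X],
        forall i, psd_operator ip (A i) &
        forall i x, P i x -> R x = 2^-1 * ip (A i x) x + ip (b i) x + c i].

Section Recovery.
Context (K : realType) (X Y : vectType K).
Context (ipX : {dot X for idfun}) (ipY : {dot Y for idfun}).
Context (Phi : 'Hom(X, Y)) (R : X -> K).

Definition optimal_solution (y0 : Y) (x0 : X) : Prop :=
  Phi x0 = y0 /\ forall x : X, Phi x = y0 -> R x0 <= R x.

Definition unique_optimal_solution (y0 : Y) (x0 : X) : Prop :=
  optimal_solution y0 x0 /\ forall x : X, optimal_solution y0 x -> x = x0.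

Definition strong_optimal_solution (y0 : Y) (x0 : X) : Prop :=
  Phi x0 = y0 /\
  exists kappa eps : K, [/\ 0 < kappa, 0 < eps &
    forall x : X, Phi x = y0 -> enorm ipX (x - x0) <= eps ->
      kappa / 2 * enorm ipX (x - x0) ^+ 2 <= R x - R x0].

Definition regularized_objective (y : Y) (mu : K) (x : X) : K :=
  2^-1 * enorm ipY (Phi x - y) ^+ 2 + mu * R x.

Definition regularized_solution (y : Y) (mu : K) (x : X) : Prop :=
  forall z : X, regularized_objective y mu x <= regularized_objective y mu z.

Definition stable_recovery (y0 : Y) (x0 : X) : Prop :=
  forall c : K, 0 < c ->
    exists L deltabar : K, [/\ 0 < L, 0 < deltabar &
      forall (delta : K) (y : Y) (x : X),
        0 < delta -> delta < deltabar -> enorm ipY (y - y0) <= delta ->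
        regularized_solution y (c * delta) x ->
        enorm ipX (x - x0) <= L * delta].

End Recovery.

(* Main.v *)
Require Import Defs.
From mathcomp Require Import all_boot all_order all_algebra.
From mathcomp Require Import boolp classical_sets reals interval_inference.
From mathcomp Require Import topology normedtype convex.
From mathcomp Require Import ring lra.

(** The multiplier rule ([optimal_multiplier]) gives, at any solution [x0] of
    the constrained problem, a vector [v] with
    [R x0 + <v, Phi x - y0> <= R x] for all [x]. Everything that compares the
    regularized problem with the constrained one goes through it.

    Stable recovery forces uniqueness. If [x] is any solution and [v] a
    multiplier at [x], completing the square shows that [x] also solves the
    regularized problem for the data [y0 + mu v], for every [mu > 0]. With
    [mu = c delta] and [c = 1 / (1 + |v|)] these data are within [delta] of
    [y0], so stable recovery gives [|x - x0| <= L delta] for all small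
    [delta], that is [x = x0].

    Uniqueness forces stable recovery. Comparing a regularized solution [x]
    with [x0] and bounding [R x - R x0] below by the multiplier yields
    [|Phi x - y0| = O(delta)] and [R x - R x0 = O(delta)]; compactness of a
    sphere and convexity turn this into [x -> x0] ([near_optimal_near]).
    Quadratic growth of [R] would only give the rate [sqrt delta]. The linear
    rate comes from the fact that [x] minimizes [R] on its own fibre of [Phi],
    together with the polyhedral structure ([fibre_min_lipschitz]). Otherwise
    there are such minimizers [x0 + t x'] with [t] small and [x'] near a unit
    vector [u] in the kernel of [Phi]. On a piece of [R] meeting the ray from
    [x0] along [u], one may move back from [x0 + t x'] along [u] by up to
    [t / 2] without leaving the piece ([polyhedral_tangent]); this stays in the
    fibre, and uniqueness of [x0] makes [R] decrease, a contradiction.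

    Uniqueness forces strong optimality by the same local analysis: on each
    piece through [x0] the slope and the curvature along a kernel direction
    are nonnegative and not both zero ([second_order_gt0]), hence, by
    compactness of the unit sphere, [R] grows quadratically
    ([quadratic_growth]). The converse is convexity along a segment.

    Statements valid for all small positive [e] are written with the filter
    [0^'+]; finitely many of them can then be combined for free, and
    [sphere_uniform] exchanges them with a quantifier over the unit sphere. *)

Set Implicit Arguments.
Unset Strict Implicit.
Unset Printing Implicit Defensive.

Import Order.TTheory GRing.Theory Num.Theory numFieldNormedType.Exports.
Import VectorInternalTheory.
Local Open Scope classical_set_scope.
Local Open Scope ring_scope.

(** * Inner products and their norms *)

Section InnerProduct.
Context (K : realType) (X : vectType K) (ip : {dot X for idfun}).
Implicit Types (u v w x : X) (a t : K).

Local Notation N := (enorm ip).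

Lemma ipC u v : ip u v = ip v u.
Proof. by rewrite (hermC ip) expr0 mul1r. Qed.

Lemma ipDl u v w : ip (u + v) w = ip u w + ip v w.
Proof. exact: linearDl. Qed.
Lemma ipBl u v w : ip (u - v) w = ip u w - ip v w.
Proof. exact: linearBl. Qed.
Lemma ipNl u w : ip (- u) w = - ip u w.
Proof. exact: linearNl. Qed.
Lemma ipZl a u w : ip (a *: u) w = a * ip u w.
Proof. exact: linearZl_LR. Qed.
Lemma ipDr w u v : ip w (u + v) = ip w u + ip w v.
Proof. by rewrite ipC ipDl !(ipC w). Qed.
Lemma ipBr w u v : ip w (u - v) = ip w u - ip w v.
Proof. by rewrite ipC ipBl !(ipC w). Qed.
Lemma ipNr w u : ip w (- u) = - ip w u.
Proof. by rewrite ipC ipNl (ipC w). Qed.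
Lemma ipZr a w u : ip w (a *: u) = a * ip w u.
Proof. by rewrite ipC ipZl (ipC w). Qed.
Lemma ip0r u : ip u 0 = 0.
Proof. by rewrite -(scale0r u) ipZr mul0r. Qed.
Lemma ip0l u : ip 0 u = 0.
Proof. by rewrite ipC ip0r. Qed.

Lemma ip_gt0 u : u != 0 -> 0 < ip u u.
Proof. exact: neq0_dnorm_gt0. Qed.

Lemma ip_ge0 u : 0 <= ip u u.
Proof. by have [->|/ip_gt0/ltW//] := eqVneq u 0; rewrite ip0l. Qed.

Lemma enorm_ge0 u : 0 <= N u.
Proof. exact: sqrtr_ge0. Qed.

Lemma enorm_sqr u : N u ^+ 2 = ip u u.
Proof. by rewrite sqr_sqrtr ?ip_ge0. Qed.

Lemma enorm_eq0 u : N u = 0 -> u = 0.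
Proof.
move=> Nu0; apply/eqP; apply: contraT => /ip_gt0.
by rewrite -enorm_sqr Nu0 expr0n ltxx.
Qed.

Lemma enorm_gt0 u : u != 0 -> 0 < N u.
Proof. by move=> /ip_gt0; rewrite sqrtr_gt0. Qed.

Lemma enorm0 : N 0 = 0.
Proof. by rewrite /enorm ip0l sqrtr0. Qed.

Lemma enormZ a u : N (a *: u) = `|a| * N u.
Proof.
by rewrite /enorm ipZl ipZr mulrA -expr2 sqrtrM ?sqr_ge0// sqrtr_sqr.
Qed.

Lemma enormN u : N (- u) = N u.
Proof. by rewrite -scaleN1r enormZ normrN1 mul1r. Qed.

Lemma enormBC u v : N (u - v) = N (v - u).
Proof. by rewrite -enormN opprB. Qed.

(** Cauchy--Schwarz: the square of [|v| u - |u| v] is nonnegative. *)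
Lemma ip_le_enorm u v : ip u v <= N u * N v.
Proof.
have [->|/enorm_gt0 Nu] := eqVneq u 0; first by rewrite ip0l enorm0 mul0r.
have [->|/enorm_gt0 Nv] := eqVneq v 0; first by rewrite ip0r enorm0 mulr0.
have := ip_ge0 (N v *: u - N u *: v).
have -> : ip (N v *: u - N u *: v) (N v *: u - N u *: v) =
          (2 * (N u * N v)) * (N u * N v - ip u v).
  by rewrite !(ipBl, ipBr, ipZl, ipZr) (ipC v u) -!enorm_sqr; ring.
by rewrite pmulr_rge0 ?subr_ge0// !mulr_gt0.
Qed.

Lemma normr_ip_le u v : `|ip u v| <= N u * N v.
Proof.
by rewrite ler_norml ip_le_enorm andbT lerNl -ipNl -(enormN u) ip_le_enorm.
Qed.

Lemma enormD u v : N (u + v) <= N u + N v.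
Proof.
rewrite -(@ler_pXn2r _ 2)// ?nnegrE ?addr_ge0 ?enorm_ge0//.
rewrite enorm_sqr ipDl !ipDr (ipC v u) -!enorm_sqr.
have := ip_le_enorm u v; lra.
Qed.

Lemma enormB u v : N (u - v) <= N u + N v.
Proof. by rewrite -(enormN v) enormD. Qed.

Lemma enorm_sum (I : Type) (r : seq I) (F : I -> X) :
  N (\sum_(i <- r) F i) <= \sum_(i <- r) N (F i).
Proof.
elim/big_rec2: _ => [|i y x _ le_xy]; first by rewrite enorm0.
by rewrite (le_trans (enormD _ _))// lerD2l.
Qed.

End InnerProduct.

(** * Compactness of the unit sphere *)

(** Compactness as an exchange of quantifiers: a property that holds around
    each point with a scale [e] depending on the point, and that is inherited
    by smaller scales, holds on the whole compact set with one scale. *)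
Lemma compact_uniform (K : realType) (n : nat) (A : set 'rV[K]_n)
    (Q : K -> 'rV[K]_n -> Prop) :
  compact A ->
  (forall (e e' : K) v, 0 < e' -> e' <= e -> Q e v -> Q e' v) ->
  (forall v : 'rV_n, A v -> \forall e \near 0^'+,
    forall w : 'rV_n, `|w - v| <= e -> Q e w) ->
  \forall e \near 0^'+, forall v, A v -> Q e v.
Proof.
move=> /compact_near_coveringP cA Qanti Qloc.
apply: (cA K 0^'+ Q) => v /Qloc Qv.
have [e [Qe e0]] := filter_ex (filterI Qv (nbhs_right_gt 0)).
near=> w i => /=; apply: (Qanti e).
- by near: i; exact: nbhs_right_gt.
- by near: i; exact: nbhs_right_le.
apply: Qe; near: w; apply/nbhs_ballP; exists e => //= w.
by rewrite -ball_normE /= distrC => /ltW.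
Unshelve. all: by end_near. Qed.

Lemma compact_level (K : realType) (n : nat) (f : 'rV[K]_n -> K) (C : K) :
  continuous f -> (forall v, f v = 1 -> `|v| <= C) ->
  compact [set v | f v = 1].
Proof.
move=> cf fC; apply: bounded_closed_compact.
  exists C; split; first exact: num_real.
  by move=> M CM v /= /fC /le_trans; apply; exact: ltW.
exact: (iffLR (continuous_closedP f) cf [set x | x = 1] (@closed_eq K 1)).
Qed.

Lemma dist_le_continuous (K : realType) (V : normedModType K) (f : V -> K)
    (D : K) :
  0 < D -> (forall v w, `|f v - f w| <= D * `|v - w|) -> continuous f.
Proof.
move=> D0 fD v; apply/cvgrPdist_le => /= e e0; near=> w.
rewrite (le_trans (fD _ _))// mulrC -ler_pdivlMr//.
by near: w; apply: cvgr_dist_le; rewrite ?divr_gt0.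
Unshelve. all: by end_near. Qed.

Section FiniteDimension.
Context (K : realType) (X Y : vectType K).
Context (ipY : {dot Y for idfun}).

(** A bound in coordinates, from the images of the basis vectors. With [T] the
    identity it says that the Euclidean norm is Lipschitz in coordinates. *)
Lemma enorm_le_coord (T : 'Hom(X, Y)) :
  exists2 C : K, 0 < C & forall x, enorm ipY (T x) <= C * `|v2r x|.
Proof.
exists (1 + \sum_i enorm ipY (T (r2v (delta_mx 0 i)))).
  by rewrite ltr_wpDr// sumr_ge0// => i _; exact: enorm_ge0.
move=> x; rewrite -{1}(v2rK x) {1}(row_sum_delta (v2r x)) !linear_sum/=.
apply: (le_trans (enorm_sum _ _ _)).
rewrite mulrDl mul1r mulr_suml ler_wpDl// ler_sum// => i _.
rewrite !linearZ /= enormZ mulrC ler_wpM2l ?enorm_ge0//.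
rewrite [leRHS]/Num.Def.normr/= mx_normrE.
by rewrite (le_bigmax _ (fun ij => `|v2r x ij.1 ij.2|) (0, i)).
Qed.

End FiniteDimension.

Section Sphere.
Context (K : realType) (X : vectType K) (ip : {dot X for idfun}).
Local Notation N := (enorm ip).

(** The other half of the equivalence of norms: the Euclidean norm is bounded
    below on the compact unit sphere of the coordinate norm. *)
Lemma coord_le_enorm :
  exists2 C : K, 0 < C & forall x, `|v2r x| <= C * N x.
Proof.
have [D D0 ND] := enorm_le_coord ip \1%VF.
have cS : compact [set v : 'rV[K]_(dim X) | `|v| = 1].
  by apply: (compact_level (C := 1)) => [|v ->//]; exact: norm_continuous.
have Nge : \forall e \near 0^'+, forall v : 'rV[K]_(dim X),
    `|v| = 1 -> e <= N (r2v v).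
  apply: (compact_uniform (Q := fun e v => e <= N (r2v v)) cS) => [e e' v _|].
    exact: le_trans.
  move=> v /= v1; have Nv : 0 < N (r2v v).
    apply: enorm_gt0; apply/eqP => v0; have := v1.
    by rewrite -(r2vK v) v0 linear0 normr0 => /esym/eqP; rewrite oner_eq0.
  have D10 : 0 < 1 + D by rewrite addr_gt0.
  near=> e => w wv.
  have : N (r2v v) <= N (r2v w) + D * e.
    rewrite -{1}(subrK (r2v w) (r2v v)) addrC (le_trans (enormD _ _ _))//.
    rewrite lerD2l -linearB /= -[r2v _]id_lfunE (le_trans (ND _))//.
    by rewrite r2vK distrC; apply: ler_wpM2l => //; exact: ltW.
  have : (1 + D) * e <= N (r2v v).
    by rewrite mulrC -ler_pdivlMr//; near: e; apply: nbhs_right_le; rewrite divr_gt0.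
  lra.
have [e [Ne e0]] := filter_ex (filterI Nge (nbhs_right_gt 0)).
exists e^-1; first by rewrite invr_gt0.
move=> x; have [->|x0] := eqVneq x 0.
  by rewrite linear0 normr0 mulr_ge0 ?enorm_ge0// invr_ge0 ltW.
have vx0 : 0 < `|v2r x|.
  by rewrite normr_gt0; apply: contra x0 => /eqP vx0; rewrite -(v2rK x) vx0 linear0.
have := Ne (`|v2r x|^-1 *: v2r x).
rewrite /= normrZ normfV normr_id mulVf ?gt_eqF// => /(_ erefl).
rewrite linearZ /= v2rK enormZ normfV normr_id.
by rewrite ler_pdivlMl// mulrC -ler_pdivlMl.
Unshelve. all: by end_near. Qed.

(** [compact_uniform] for the Euclidean unit sphere of an abstract space,
    whose image in coordinates is closed and bounded. *)
Lemma sphere_uniform (Q : K -> X -> Prop) :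
  (forall (e e' : K) x, 0 < e' -> e' <= e -> Q e x -> Q e' x) ->
  (forall u, N u = 1 ->
     \forall e \near 0^'+, forall x, N (x - u) <= e -> Q e x) ->
  \forall e \near 0^'+, forall x, N x = 1 -> Q e x.
Proof.
move=> Qanti Qloc.
have [D D0 ND] := enorm_le_coord ip \1%VF.
have [C C0 NC] := coord_le_enorm.
have Nlip v w : `|N (r2v v) - N (r2v w)| <= D * `|v - w|.
  have ND' u : N (r2v u) <= D * `|u|.
    by rewrite -{2}(r2vK u) -{1}[r2v u]id_lfunE ND.
  have tri v' w' : N (r2v w') <= N (r2v v') + D * `|v' - w'|.
    rewrite -[r2v w'](subrK (r2v v')) addrC (le_trans (enormD _ _ _))//.
    by rewrite lerD2l -linearB distrC ND'.
  have := tri v w; have := tri w v; rewrite (distrC w v) ler_norml; lra.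
have cN : continuous (fun v : 'rV[K]_(dim X) => N (r2v v)).
  exact: dist_le_continuous Nlip.
have cS : compact [set v : 'rV[K]_(dim X) | N (r2v v) = 1].
  apply: (compact_level (C := C)) => // v v1.
  by rewrite -[v]r2vK (le_trans (NC _))// v1 mulr1.
have := compact_uniform (Q := fun e v => Q e (r2v v)) cS _ _.
move=> /(_ (fun e e' v => Qanti e e' (r2v v))) H.
have {}H : \forall e \near 0^'+, forall v, N (r2v v) = 1 -> Q e (r2v v).
  apply: H => v /= /Qloc Qv.
  have [e [Qe e0]] := filter_ex (filterI Qv (nbhs_right_gt 0)).
  near=> d => w wv; apply: (Qanti e).
  - by near: d; exact: nbhs_right_gt.
  - by near: d; exact: nbhs_right_le.
  apply: Qe.
  rewrite -linearB /= -[r2v _]id_lfunE (le_trans (ND _))// r2vK.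
  rewrite mulrC -ler_pdivlMr// (le_trans wv)//.
  by near: d; apply: nbhs_right_le; rewrite divr_gt0.
by apply: filterS H => e Qe x Nx; rewrite -[x]v2rK; apply: Qe; rewrite v2rK.
Unshelve. all: by end_near. Qed.

End Sphere.

(** * Lagrange multipliers for convex functions *)

Section Multiplier.
Context (K : realType) (X Y : vectType K) (ipY : {dot Y for idfun}).
Context (Phi : 'Hom(X, Y)).

(** Convexity with a plain scalar as weight, a form in which adding a linear
    term is a matter of arithmetic. *)
Definition jensen (p : X -> K) := forall t x y, 0 <= t -> t <= 1 ->
  p (t *: x + (1 - t) *: y) <= t * p x + (1 - t) * p y.

Lemma convex_functionE (p : X -> K) :
  convex_function [set: convex_lmodType X] p -> jensen p.
Proof.
move=> cp t x y t0 t1.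
exact: (cp (Itv01 t0 t1) x y (in_setT _) (in_setT _)).
Qed.

(** The linear constraints [<e, Phi h> = 0], for [e] in [s], are removed one
    after the other. Removing [e] amounts to finding a slope [l] between the
    difference quotients of [p] at the points with [<e, Phi h> < 0] and those
    at the points with [<e, Phi h> > 0]; convexity orders these quotients, so
    the supremum of the former will do. *)
Lemma lagrange_multipliers (s : seq Y) (p : X -> K) : jensen p ->
  (forall h, (forall e, e \in s -> ipY e (Phi h) = 0) -> p 0 <= p h) ->
  exists v, forall h, p 0 + ipY v (Phi h) <= p h.
Proof.
elim: s p => [|e s IHs] p cp minp.
  by exists 0 => h; rewrite ip0l addr0 minp.
pose D h := forall e', e' \in s -> ipY e' (Phi h) = 0.
pose f h := ipY e (Phi h).
have fE t h k : f (t *: h + (1 - t) *: k) = t * f h + (1 - t) * f k.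
  by rewrite /f linearD !linearZ /= ipDr !ipZr.
have fN h : f (- h) = - f h by rewrite /f linearN ipNr.
have DN h : D h -> D (- h).
  by move=> Dh e' /Dh; rewrite linearN ipNr => ->; rewrite oppr0.
have slope h k : D h -> D k -> f h < 0 -> 0 < f k ->
    (p h - p 0) / f h <= (p k - p 0) / f k.
  move=> Dh Dk fh fk; pose t := f k / (f k - f h).
  have fkh : 0 < f k - f h by lra.
  (* The weight for which the segment from [h] to [k] meets the kernel of
     [f]. *)
  have t0 : 0 <= t by rewrite divr_ge0 ?ltW.
  have t1 : t <= 1 by rewrite ler_pdivrMr// mul1r; lra.
  have le_p : p 0 <= p (t *: h + (1 - t) *: k).
    apply: minp => e'; rewrite inE => /orP[/eqP->|e's].
      by rewrite -/(f _) fE /t; field; rewrite gt_eqF.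
    rewrite linearD !linearZ /= ipDr !ipZr Dh// Dk//; ring.
  rewrite ler_pdivlMr// mulrAC ler_ndivrMr//.
  have : (f k - f h) * p 0 <= (f k - f h) * (t * p h + (1 - t) * p k).
    by rewrite ler_pM2l// (le_trans le_p)// cp.
  have -> : (f k - f h) * (t * p h + (1 - t) * p k) = f k * p h - f h * p k.
    by rewrite /t; field; rewrite gt_eqF.
  lra.
have [l Hl] : exists l, forall h, D h -> p 0 + l * f h <= p h.
  have min0 h : D h -> f h = 0 -> p 0 <= p h.
    by move=> Dh fh; apply: minp => e'; rewrite inE => /orP[/eqP->|/Dh].
  have [[h0 [Dh0 fh0]]|nD] := pselect (exists h, D h /\ f h < 0); last first.
    (* [D] is symmetric: if [f] is never negative on it, then [f] vanishes. *)
    exists 0 => h Dh; rewrite mul0r addr0; apply: min0 => //.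
    have [fh|fh|//] := ltgtP (f h) 0; case: nD; first by exists h.
    by exists (- h); split; [exact: DN | rewrite fN oppr_lt0].
  pose S := [set (p h - p 0) / f h | h in [set h | D h /\ f h < 0]].
  have ubS k : D k -> 0 < f k -> ubound S ((p k - p 0) / f k).
    by move=> Dk fk _ [h [Dh fh] <-]; exact: slope.
  have S0 : S !=set0 by exists ((p h0 - p 0) / f h0), h0.
  exists (sup S) => h Dh; have [fh|fh|fh] := ltgtP (f h) 0.
  - have : (p h - p 0) / f h <= sup S.
      apply: ub_le_sup; last by exists h.
      exists ((p (- h0) - p 0) / f (- h0)).
      by apply: ubS; [exact: DN | rewrite fN oppr_gt0].
    by rewrite ler_ndivrMr//; lra.
  - by have := ge_sup S0 (ubS _ Dh fh); rewrite ler_pdivlMr//; lra.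
  - by rewrite fh mulr0 addr0 min0.
have cp' : jensen (fun h => p h - l * f h).
  move=> t x y t0 t1; rewrite fE; have := cp t x y t0 t1; lra.
have f0 : f 0 = 0 by rewrite /f linear0 ip0r.
have [|v Hv] := IHs _ cp'.
  by move=> h /Hl; rewrite f0; lra.
exists (v + l *: e) => h; have := Hv h; rewrite ipDl ipZl -/(f h) f0; lra.
Qed.

Lemma ortho_vbasis_eq0 (y : Y) :
  (forall e, e \in vbasis {:Y} -> ipY e y = 0) -> y = 0.
Proof.
move=> y0; apply: (enorm_eq0 (ip := ipY)).
rewrite /enorm {1}(coord_vbasis (memvf y)).
suff -> : ipY (\sum_i coord (vbasis fullv) i y *: (vbasis fullv)`_i) y = 0.
  by rewrite sqrtr0.
elim/big_ind: _ => [|a b a0 b0|i _]; first by rewrite ip0l.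
  by rewrite ipDl a0 b0 addr0.
by rewrite ipZl y0 ?mulr0// mem_nth// size_tuple.
Qed.

Lemma optimal_multiplier (R : X -> K) (y0 : Y) (x0 : X) :
  jensen R -> optimal_solution Phi R y0 x0 ->
  exists v, forall x, R x0 + ipY v (Phi x - y0) <= R x.
Proof.
move=> cR [Px0 optx0].
have [||v Hv] := @lagrange_multipliers (vbasis {:Y}) (fun h => R (x0 + h)).
- move=> t x y t0 t1; apply: le_trans (cR t _ _ t0 t1).
  by rewrite !scalerDr addrACA -scalerDl [t + _]addrC subrK scale1r.
- move=> h /ortho_vbasis_eq0 Ph; rewrite addr0 optx0//.
  by rewrite linearD /= Ph addr0.
exists v => x; have := Hv (x - x0).
by rewrite addr0 linearB /= Px0 [x0 + _]addrC subrK.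
Qed.

End Multiplier.

(** * Polyhedra seen from a point *)

Section Polyhedral.
Context (K : realType) (X : vectType K) (ip : {dot X for idfun}).
Implicit Types (a u w x : X) (b c t : K).
Local Notation N := (enorm ip).

Lemma ip_near_lt a u c : ip a u < c ->
  \forall e \near 0^'+, forall x, N (x - u) <= e -> ip a x < c.
Proof.
move=> auc; have a1 : 0 < 1 + N a by rewrite ltr_pwDl ?enorm_ge0.
near=> e => x xu; have e0 : 0 < e by near: e; exact: nbhs_right_gt.
have : e * (1 + N a) <= c - ip a u.
  rewrite -ler_pdivlMr//; near: e.
  by apply: nbhs_right_le; rewrite divr_gt0 ?subr_gt0.
have : ip a (x - u) <= N a * e.
  by rewrite (le_trans (ip_le_enorm _ _ _))// ler_wpM2l ?enorm_ge0.
rewrite ipBr; lra.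
Unshelve. all: by end_near. Qed.

Lemma ip_near_gt a u c : c < ip a u ->
  \forall e \near 0^'+, forall x, N (x - u) <= e -> c < ip a x.
Proof.
rewrite -ltrN2 -ipNl => /ip_near_lt; apply: filterS => e H x /H.
by rewrite ipNl ltrN2.
Qed.

Lemma ip_near_bound a u :
  exists2 M : K, 0 < M &
    \forall e \near 0^'+, forall x, N (x - u) <= e -> `|ip a x| <= M.
Proof.
exists (`|ip a u| + 1); first by rewrite ltr_wpDl.
have /ip_near_lt H1 : ip a u < `|ip a u| + 1 by have := ler_norm (ip a u); lra.
have /ip_near_gt H2 : - (`|ip a u| + 1) < ip a u.
  by have := ler_norm (- ip a u); rewrite normrN; lra.
near=> e => x xu; rewrite ler_norml !ltW//.
  by move: x xu; near: e.
by move: x xu; near: e.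
Unshelve. all: by end_near. Qed.

(** The three cases are [x0] outside the half-space or on its boundary with
    [u] pointing outwards, [x0] in the interior, and [x0] on the boundary with
    [u] pointing weakly inwards. In the last one, if [<a, u> = 0] moving along
    [u] does not change the constraint, and if [<a, u> < 0] then [<a, x>] is
    less than [<a, u> / 2] for [x] near [u], which leaves room for moving back
    by [t / 2]. *)
Lemma halfspace_tangent a b x0 u :
  (\forall e \near 0^'+, forall x t, N (x - u) <= e -> 0 < t -> t <= e ->
     b < ip a (x0 + t *: x)) \/
  [/\ ip a x0 <= b,
     \forall t \near 0^'+, ip a (x0 + t *: u) <= b &
     \forall e \near 0^'+, forall x t s, N (x - u) <= e -> 0 < t -> t <= e ->
       ip a (x0 + t *: x) <= b -> 0 <= s -> s <= t / 2 ->
       ip a (x0 + t *: x - s *: u) <= b].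
Proof.
have [M M0 HM] := ip_near_bound a u.
have Mu : `|ip a u| <= M.
  have [e [H e0]] := filter_ex (filterI HM (nbhs_right_gt 0)).
  by apply: H; rewrite subrr enorm0 ltW.
have [ltb|gtb|eqb] := ltgtP (ip a x0) b.
- right; split=> //.
    near=> t; rewrite ipDr ipZr.
    have t0 : 0 < t by near: t; exact: nbhs_right_gt.
    have : t * M <= b - ip a x0.
      rewrite -ler_pdivlMr//; near: t.
      by apply: nbhs_right_le; rewrite divr_gt0 ?subr_gt0.
    have : t * ip a u <= t * M.
      by rewrite ler_pM2l//; move: Mu; rewrite ler_norml => /andP[].
    lra.
  near=> e => x t s xu t0 te _ s0 st; rewrite ipBr ipDr !ipZr.
  have e2 : e * (2 * M) <= b - ip a x0.
    rewrite -ler_pdivlMr ?mulr_gt0//; near: e.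
    by apply: nbhs_right_le; rewrite divr_gt0 ?subr_gt0// mulr_gt0.
  have xM : `|ip a x| <= M by move: x xu; near: e.
  have : t * ip a x <= e * M.
    apply: (le_trans (ler_norm _)); rewrite normrM gtr0_norm//.
    by apply: ler_pM => //; exact: ltW.
  have : - (s * ip a u) <= e * M.
    apply: (le_trans (ler_norm _)); rewrite normrN normrM ger0_norm//.
    by apply: ler_pM => //; lra.
  lra.
- left; near=> e => x t xu t0 te; rewrite ipDr ipZr.
  have e2 : e * (2 * M) <= ip a x0 - b.
    rewrite -ler_pdivlMr ?mulr_gt0//; near: e.
    by apply: nbhs_right_le; rewrite divr_gt0 ?subr_gt0// mulr_gt0.
  have xM : `|ip a x| <= M by move: x xu; near: e.
  have : - (t * ip a x) <= e * M.
    apply: (le_trans (ler_norm _)); rewrite normrN normrM gtr0_norm//.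
    by apply: ler_pM => //; exact: ltW.
  have : 0 < e * M by rewrite mulr_gt0// (lt_le_trans t0).
  lra.
- have [/ip_near_gt au|au] := ltP 0 (ip a u).
    left; apply: filterS au => e au x t /au ax t0 _.
    by rewrite ipDr ipZr eqb ltrDl mulr_gt0.
  right; split; first by [].
    near=> t; have t0 : 0 < t by near: t; exact: nbhs_right_gt.
    by rewrite ipDr ipZr eqb gerDl mulr_ge0_le0// ltW.
  have [au0|au0] := eqVneq (ip a u) 0.
    near=> e => x t s _ t0 _ + _ _.
    by rewrite ipBr !ipZr au0 mulr0 subr0.
  have /ip_near_lt H : ip a u < ip a u / 2.
    have : ip a u < 0 by rewrite lt_neqAle au0 au.
    lra.
  apply: filterS H => e H x t s /H ax t0 _ _ s0 st.
  rewrite ipBr ipDr !ipZr eqb.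
  have : t * ip a x <= t * (ip a u / 2) by rewrite ler_pM2l// ltW.
  have : (t / 2 - s) * ip a u <= 0 by rewrite mulr_ge0_le0//; lra.
  lra.
Unshelve. all: by end_near. Qed.

(** Either [P] avoids the small vectors from [x0] in directions close to [u],
    or [u] is a feasible direction at [x0] and small steps back along [u] are
    allowed from any point of [P] near the ray. This dichotomy depends
    on polyhedrality: it fails for a disc and a tangent direction. *)
Lemma polyhedral_tangent (P : set X) x0 u : polyhedral ip P ->
  (\forall e \near 0^'+, forall x t, N (x - u) <= e -> 0 < t -> t <= e ->
     ~ P (x0 + t *: x)) \/
  [/\ P x0,
     \forall t \near 0^'+, P (x0 + t *: u) &
     \forall e \near 0^'+, forall x t s, N (x - u) <= e -> 0 < t -> t <= e ->
       P (x0 + t *: x) -> 0 <= s -> s <= t / 2 ->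
       P (x0 + t *: x - s *: u)].
Proof.
move=> [m [a [b ->]]].
have [[i Hi]|nH] := pselect (exists i, \forall e \near 0^'+, forall x t,
    N (x - u) <= e -> 0 < t -> t <= e -> b i < ip (a i) (x0 + t *: x)).
  left; apply: filterS Hi => e H x t xu t0 te /(_ i).
  by apply/negP; rewrite -ltNge; exact: H.
right.
have H i := halfspace_tangent (a i) (b i) x0 u.
have {}H i := or_ind (fun h => False_ind _ (nH (ex_intro _ i h))) id (H i).
split.
- by move=> i; case: (H i).
- by apply: filter_forall => i; case: (H i).
- have : \forall e \near 0^'+, forall i x t s,
      N (x - u) <= e -> 0 < t -> t <= e ->
      ip (a i) (x0 + t *: x) <= b i -> 0 <= s -> s <= t / 2 ->
      ip (a i) (x0 + t *: x - s *: u) <= b i.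
    by apply: filter_forall => i; case: (H i).
  apply: filterS => e He x t s xu t0 te Px s0 st i.
  by apply: He => //; exact: Px.
Qed.

Lemma polyhedral_convex (P : set X) x y t : polyhedral ip P ->
  0 <= t -> t <= 1 -> P x -> P y -> P (t *: x + (1 - t) *: y).
Proof.
move=> [m [a [b ->]]] t0 t1 Px Py i; rewrite ipDr !ipZr.
have : t * ip (a i) x <= t * b i by rewrite ler_wpM2l.
have : (1 - t) * ip (a i) y <= (1 - t) * b i.
  by rewrite ler_wpM2l ?subr_ge0.
lra.
Qed.

End Polyhedral.

(** * One quadratic piece of the function *)

Section Piece.
Context (K : realType) (X Y : vectType K).
Context (ip : {dot X for idfun}).
Context (Phi : 'Hom(X, Y)) (R : X -> K) (x0 : X).
Context (minx0 : forall h, Phi h = 0 -> h != 0 -> R x0 < R (x0 + h)).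
Context (P : set X) (A : 'End(X)) (b : X) (c : K).
Context (polyP : polyhedral ip P).
Context (psdA : psd_operator ip A).
Context (RE : forall x, P x -> R x = 2^-1 * ip (A x) x + ip b x + c).
Local Notation N := (enorm ip).
(* The gradient at [x0] of the quadratic function representing [R]. *)
Let g := A x0 + b.

Lemma quadratic_increment x h : P x -> P (x + h) ->
  R (x + h) - R x = ip (A x + b) h + 2^-1 * ip (A h) h.
Proof.
move=> Px Pxh; rewrite !RE// [A (x + h)]linearD !ipDl !ipDr.
rewrite (ipC ip (A h) x) -(proj1 psdA).
by lra.
Qed.

(** By convexity of [P] the whole segment from [x0] to [x0 + t w] lies in the
    piece; it also lies in the fibre of [x0], so [R] exceeds [R x0] on it. *)
Lemma slope_ge0 t w : P x0 -> 0 < t -> P (x0 + t *: w) -> Phi w = 0 ->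
  0 <= ip g w.
Proof.
move=> Px0 t0 Pt Pw; rewrite leNgt; apply/negP => gw.
have Aw := proj2 psdA w; have A1 : 0 < 1 + ip (A w) w by lra.
(* A step at which the quadratic term cannot compensate the slope. *)
pose s := Num.min t (- ip g w / (1 + ip (A w) w)).
have s0 : 0 < s by rewrite lt_min t0 divr_gt0//; lra.
have st : s <= t by rewrite ge_min lexx.
have sA : s * (1 + ip (A w) w) <= - ip g w.
  by rewrite -ler_pdivlMr// ge_min lexx orbT.
have Ps : P (x0 + s *: w).
  have -> : x0 + s *: w = (s / t) *: (x0 + t *: w) + (1 - s / t) *: x0.
    rewrite scalerDr addrAC -scalerDl [s / t + _]addrC subrK scale1r scalerA.
    by rewrite divfK ?gt_eqF.
  apply: (polyhedral_convex polyP) => //; first by rewrite divr_ge0 ?ltW.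
  by rewrite ler_pdivrMr// mul1r.
have w0 : w != 0 by apply: contraTneq gw => ->; rewrite ip0r ltxx.
have : 0 < R (x0 + s *: w) - R x0.
  rewrite subr_gt0; apply: minx0; first by rewrite linearZ /= Pw scaler0.
  by rewrite scaler_eq0 negb_or w0 gt_eqF.
rewrite quadratic_increment// [A (_ *: _)]linearZ /= ipZl !ipZr -/g.
have -> : s * ip g w + 2^-1 * (s * (s * ip (A w) w)) =
  s * (ip g w + 2^-1 * (s * ip (A w) w)) by ring.
rewrite pmulr_rgt0//; lra.
Qed.

(** Slope and curvature are nonnegative; if both vanished, [R] would be
    constant along [u], against strict minimality. Each of them
    may vanish, but their sum stays positive for directions close to [u]. *)
Lemma second_order_gt0 u : u != 0 -> Phi u = 0 -> P x0 ->
  (\forall t \near 0^'+, P (x0 + t *: u)) ->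
  0 <= ip g u /\ 0 < ip g u + ip (A u) u.
Proof.
move=> u0 Pu Px0 /filterI /(_ (filterI (nbhs_right_gt 0) (nbhs_right_le ltr01))).
move=> /filter_ex [t [Pt [t0 t1]]].
have gu := slope_ge0 Px0 t0 Pt Pu; have Au := proj2 psdA u; split=> //.
have : 0 < R (x0 + t *: u) - R x0.
  rewrite subr_gt0; apply: minx0; first by rewrite linearZ /= Pu scaler0.
  by rewrite scaler_eq0 negb_or u0 gt_eqF.
rewrite quadratic_increment// [A (_ *: _)]linearZ /= ipZl !ipZr -/g.
have -> : t * ip g u + 2^-1 * (t * (t * ip (A u) u)) =
  t * (ip g u + 2^-1 * (t * ip (A u) u)) by ring.
rewrite pmulr_rgt0//.
have : t * ip (A u) u <= 1 * ip (A u) u by rewrite ler_wpM2r.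
lra.
Qed.

(** A convex quadratic form lies above its tangent at [u]; this replaces a
    quadratic function of [x] by an affine one. *)
Lemma psd_tangent u x : 2 * ip (A u) x - ip (A u) u <= ip (A x) x.
Proof.
have := proj2 psdA (x - u); rewrite [A _]linearB /= !(ipBl, ipBr).
by rewrite (proj1 psdA x u) (ipC ip x (A u)); lra.
Qed.

(** Along a direction [x] near [u] the slope is nonnegative by [slope_ge0],
    and slope plus curvature stays bounded away from [0]; as [t <= 1], the
    increment is at least half of [t ^+ 2] times this sum. *)
Lemma growth_piece u : u != 0 -> Phi u = 0 ->
  \forall e \near 0^'+, forall x t, N (x - u) <= e -> 0 < t -> t <= e ->
    Phi x = 0 -> P (x0 + t *: x) -> e * t ^+ 2 <= R (x0 + t *: x) - R x0.
Proof.
move=> u0 Pu; have [H|[Px0 Pt _]] := polyhedral_tangent x0 u polyP.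
  by apply: filterS H => e H x t xu t0 te _ /(H _ _ xu t0 te).
have [gu F0] := second_order_gt0 u0 Pu Px0 Pt.
pose F := ip g u + ip (A u) u.
have /(ip_near_gt (ip := ip)) HF : F / 2 + ip (A u) u < ip (g + 2 *: A u) u.
  by rewrite ipDl ipZl /F; lra.
near=> e => x t xu t0 te Px Ptx.
have gx := slope_ge0 Px0 t0 Ptx Px.
have Fx : F / 2 <= ip g x + ip (A x) x.
  have : F / 2 + ip (A u) u < ip (g + 2 *: A u) x by move: x xu {Px Ptx gx}; near: e.
  by rewrite ipDl ipZl; have := psd_tangent u x; lra.
have e1 : e <= 1 by near: e; exact: nbhs_right_le.
have eF : e <= F / 4 by near: e; apply: nbhs_right_le; rewrite divr_gt0.
rewrite quadratic_increment// [A (_ *: _)]linearZ /= ipZl !ipZr -/g.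
have -> : t * ip g x + 2^-1 * (t * (t * ip (A x) x)) =
  2^-1 * (t * (1 - t) * ip g x + t * ip g x + t ^+ 2 * (ip g x + ip (A x) x)).
  by field.
have : 0 <= t * (1 - t) * ip g x by rewrite !mulr_ge0//; lra.
have : 0 <= t * ip g x by rewrite mulr_ge0// ltW.
have : t ^+ 2 * (F / 2) <= t ^+ 2 * (ip g x + ip (A x) x).
  by rewrite ler_wpM2l ?sqr_ge0.
have : e * t ^+ 2 <= (F / 4) * t ^+ 2 by rewrite ler_wpM2r ?sqr_ge0.
lra.
Unshelve. all: by end_near. Qed.

(** Moving back from [x0 + t x] along [u] stays in the fibre of [Phi], and in
    the piece for a short while. The derivative of [R] along [u] there is
    [<g, u> + t <A u, x>], positive by [second_order_gt0], so that [R]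
    decreases. *)
Lemma fibre_min_piece u : u != 0 -> Phi u = 0 ->
  \forall e \near 0^'+, forall x t, N (x - u) <= e -> 0 < t -> t <= e ->
    P (x0 + t *: x) ->
    ~ (forall z, Phi z = Phi (x0 + t *: x) -> R (x0 + t *: x) <= R z).
Proof.
move=> u0 Pu; have [H|[Px0 Pt Ps]] := polyhedral_tangent x0 u polyP.
  by apply: filterS H => e H x t xu t0 te /(H _ _ xu t0 te).
have [gu F0] := second_order_gt0 u0 Pu Px0 Pt.
have /(ip_near_gt (ip := ip)) HF : - ip g u < ip (A u) u by lra.
near=> e => x t xu t0 te Ptx minx.
have Fx : - ip g u < ip (A u) x by move: x xu {Ptx minx}; near: e.
have e1 : e <= 1 by near: e; exact: nbhs_right_le.
pose G := ip g u + t * ip (A u) x.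
have G0 : 0 < G.
  (* A convex combination of the slope along [u] and of the perturbed sum of
     slope and curvature. *)
  have -> : G = (1 - t) * ip g u + t * (ip g u + ip (A u) x) by rewrite /G; ring.
  rewrite ltr_wpDl//; first by rewrite mulr_ge0//; lra.
  by rewrite mulr_gt0//; lra.
have Au := proj2 psdA u; have A1 : 0 < 1 + ip (A u) u by lra.
pose s := Num.min (t / 2) (G / (1 + ip (A u) u)).
have s0 : 0 < s by rewrite lt_min !divr_gt0.
have st : s <= t / 2 by rewrite ge_min lexx.
have sA : s * (1 + ip (A u) u) <= G.
  by rewrite -ler_pdivlMr// ge_min lexx orbT.
have Pz : P (x0 + t *: x - s *: u).
  have Ps' := near Ps e.
  by apply: Ps' => //; exact: ltW.
have /minx : Phi (x0 + t *: x - s *: u) = Phi (x0 + t *: x).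
  by rewrite -scaleNr addrC linearD linearZ /= Pu scaler0 add0r.
rewrite -subr_ge0 -scaleNr quadratic_increment ?scaleNr// leNgt => /negP; apply.
rewrite -!scaleNr [A (_ *: u)]linearZ [A (x0 + _)]linearD /= [A (t *: x)]linearZ /=.
rewrite !ipZr !(ipDl, ipZl).
have -> : ip (A x) u = ip (A u) x by rewrite (proj1 psdA) ipC.
have -> : - s * (ip (A x0) u + t * ip (A u) x + ip b u) +
    2^-1 * (- s * (- s * ip (A u) u)) = - (s * (G - 2^-1 * (s * ip (A u) u))).
  by rewrite /G /g ipDl; ring.
rewrite oppr_lt0 mulr_gt0//; lra.
Unshelve. all: by end_near. Qed.

End Piece.

(** * Growth, Lipschitz and localization estimates *)

Section Operator.
Context (K : realType) (X Y : vectType K).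
Context (ipX : {dot X for idfun}) (ipY : {dot Y for idfun}).

Lemma enorm_lin_bounded (T : 'Hom(X, Y)) :
  exists2 C : K, 0 < C & forall x, enorm ipY (T x) <= C * enorm ipX x.
Proof.
have [C C0 HC] := enorm_le_coord ipY T; have [D D0 HD] := coord_le_enorm ipX.
exists (C * D); first exact: mulr_gt0.
by move=> x; rewrite (le_trans (HC x))// -mulrA ler_pM2l.
Qed.

Lemma enorm_near_ge (T : 'Hom(X, Y)) (u : X) : T u != 0 ->
  \forall e \near 0^'+, forall x, enorm ipX (x - u) <= e -> e <= enorm ipY (T x).
Proof.
move=> /(enorm_gt0 ipY) Tu; have [C C0 HC] := enorm_lin_bounded T.
have C1 : 0 < 1 + C by rewrite addr_gt0.
near=> e => x xu.
have : e * (1 + C) <= enorm ipY (T u).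
  by rewrite -ler_pdivlMr//; near: e; apply: nbhs_right_le; rewrite divr_gt0.
have : enorm ipY (T u) <= enorm ipY (T x) + enorm ipY (T (x - u)).
  by rewrite -{1}(subKr (T x) (T u)) -linearB enormB.
have : enorm ipY (T (x - u)) <= C * e.
  by rewrite (le_trans (HC _))// ler_pM2l.
lra.
Unshelve. all: by end_near. Qed.

End Operator.

Section Recover.
Context (K : realType) (X Y : vectType K).
Context (ipX : {dot X for idfun}) (ipY : {dot Y for idfun}).
Context (Phi : 'Hom(X, Y)) (R : X -> K).
Local Notation N := (enorm ipX).
Local Notation NY := (enorm ipY).

Lemma unit_neq0 u : N u = 1 -> u != 0.
Proof.
move=> u1; apply/eqP => u0; move: u1.
by rewrite u0 enorm0 => /esym/eqP; rewrite oner_eq0.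
Qed.

Lemma polar (x x0 : X) : x != x0 ->
  exists w t, [/\ N w = 1, 0 < t, t = N (x - x0) & x = x0 + t *: w].
Proof.
rewrite -subr_eq0 => /(enorm_gt0 ipX) t0.
exists ((N (x - x0))^-1 *: (x - x0)), (N (x - x0)); split=> //.
  by rewrite enormZ normfV gtr0_norm// mulVf// gt_eqF.
by rewrite scalerA divff ?gt_eqF// scale1r addrC subrK.
Qed.

Lemma unique_strict_min (y0 : Y) (x0 : X) :
  unique_optimal_solution Phi R y0 x0 ->
  forall h, Phi h = 0 -> h != 0 -> R x0 < R (x0 + h).
Proof.
move=> [[Px0 optx0] ux0] h Ph h0.
have Pxh : Phi (x0 + h) = y0 by rewrite linearD /= Ph addr0.
rewrite lt_neqAle optx0// andbT; apply: contra_neqN h0 => /eqP eqR.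
suff /eqP : x0 + h = x0 by rewrite -subr_eq0 addrC addKr => /eqP.
by apply: ux0; split=> // z Pz; rewrite -eqR optx0.
Qed.

(** By convexity [R] is at most [R x0] on the segment from [x0] to another
    solution, which contradicts growth at its points close to [x0]. *)
Lemma strong_unique (y0 : Y) (x0 : X) : jensen R ->
  optimal_solution Phi R y0 x0 ->
  strong_optimal_solution ipX Phi R y0 x0 ->
  unique_optimal_solution Phi R y0 x0.
Proof.
move=> cR optx0 [Px0 [k [e [k0 e0 H]]]]; split=> // x [Px optx].
apply/eqP; apply: contraT => /polar[w [t [w1 t0 tE xE]]].
pose s := Num.min 1 (e / t).
have s0 : 0 < s by rewrite lt_min ltr01 divr_gt0.
have s1 : s <= 1 by rewrite ge_min lexx.
have se : s * t <= e by rewrite -ler_pdivlMr// ge_min lexx orbT.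
have sE : s *: x + (1 - s) *: x0 = x0 + (s * t) *: w.
  by rewrite xE scalerDr addrAC -scalerDl [s + _]addrC subrK scale1r scalerA.
have Nst : N (s *: x + (1 - s) *: x0 - x0) = s * t.
  by rewrite sE addrC addKr enormZ w1 mulr1 gtr0_norm// mulr_gt0.
have := cR s x x0 (ltW s0) s1; have := H (s *: x + (1 - s) *: x0).
rewrite Nst => /(_ _ se) H1 H2.
have Pz : Phi (s *: x + (1 - s) *: x0) = y0.
  by rewrite linearD !linearZ /= Px Px0 -scalerDl [s + _]addrC subrK scale1r.
have {H1} := H1 Pz; have Rx : R x = R x0.
  by apply/eqP; rewrite eq_le optx// (proj2 optx0).
have : 0 < k / 2 * (s * t) ^+ 2 by rewrite !mulr_gt0// exprn_gt0// mulr_gt0.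
move: H2; rewrite Rx; lra.
Qed.

(** With [v] a multiplier at the solution [x], the point [x] solves the
    regularized problem for the data [y0 + mu v], whatever [mu > 0]:
    expanding the square, the cross term [- mu <v, Phi z - y0>] is absorbed by
    [mu (R z - R x)]. *)
Lemma stable_unique (y0 : Y) (x0 : X) : jensen R ->
  optimal_solution Phi R y0 x0 -> stable_recovery ipX ipY Phi R y0 x0 ->
  unique_optimal_solution Phi R y0 x0.
Proof.
move=> cR optx0 stab; split=> // x optx.
have [v Hv] := optimal_multiplier ipY cR optx.
have v1 : 0 < 1 + NY v by rewrite ltr_pwDl ?enorm_ge0.
(* This choice of [c] keeps [y0 + (c d) v] within [d] of [y0]. *)
pose c := (1 + NY v)^-1; have c0 : 0 < c by rewrite invr_gt0.
have [L [D [L0 D0 H]]] := stab c c0.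
have solx d : 0 < d -> d < D -> N (x - x0) <= L * d.
  move=> d0 dD; apply: (H d (y0 + (c * d) *: v)) => //.
    rewrite addrC addKr enormZ gtr0_norm ?mulr_gt0// mulrAC.
    by rewrite ger_pMl// mulrC ler_pdivrMr// mul1r; lra.
  move=> z; rewrite /regularized_objective (proj1 optx) !enorm_sqr.
  have -> : y0 - (y0 + (c * d) *: v) = - ((c * d) *: v).
    by rewrite opprD addrA subrr add0r.
  have -> : Phi z - (y0 + (c * d) *: v) = (Phi z - y0) - (c * d) *: v.
    by rewrite opprD addrA.
  have := Hv z; have := ip_ge0 ipY (Phi z - y0).
  move: (Phi z - y0) => h h0; rewrite -(@ler_pM2l _ (c * d)) ?mulr_gt0// => Hz.
  rewrite !(ipBl, ipBr, ipNl, ipNr, ipZl, ipZr) (ipC ipY h v); lra.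
apply/eqP; rewrite -subr_eq0; apply: contraT => xx0.
have x1 := enorm_gt0 ipX xx0.
(* For this [d] the bound [solx] halves the distance it estimates. *)
pose d := Num.min (D / 2) (N (x - x0) / L / 2).
have d0 : 0 < d by rewrite lt_min !divr_gt0.
have dD : d < D by rewrite gt_min; apply/orP; left; lra.
have dL : d <= N (x - x0) / L / 2 by rewrite ge_min lexx orbT.
have := solx d d0 dD; have : L * d <= L * (N (x - x0) / L / 2) by rewrite ler_pM2l.
have -> : L * (N (x - x0) / L / 2) = N (x - x0) / 2.
  by field; rewrite gt_eqF.
lra.
Qed.

Context (x0 : X).
Context (minx0 : forall h, Phi h = 0 -> h != 0 -> R x0 < R (x0 + h)).

Lemma quadratic_growth : convex_plq ipX R ->
  \forall e \near 0^'+, forall w, N w = 1 -> forall t, 0 < t -> t <= e ->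
    Phi w = 0 -> e * t ^+ 2 <= R (x0 + t *: w) - R x0.
Proof.
move=> [_ [k [P [A [b [c [polyP covP psdA RE]]]]]]].
apply: sphere_uniform => [e e' x e0 ee' H t t0 te Px|u u1].
  by rewrite (le_trans _ (H t t0 _ Px)) ?(le_trans te)// ler_wpM2r ?sqr_ge0.
have [Pu|Pu] := eqVneq (Phi u) 0; last first.
  have := enorm_near_ge ipX ipY Pu; have := @nbhs_right_gt K 0.
  apply: filterS2 => e e0 H x /H {}H t _ _ Px.
  by move: H; rewrite Px enorm0 leNgt e0.
have : \forall e \near 0^'+, forall i x t, N (x - u) <= e -> 0 < t -> t <= e ->
    Phi x = 0 -> P i (x0 + t *: x) -> e * t ^+ 2 <= R (x0 + t *: x) - R x0.
  apply: filter_forall => i.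
  exact: (growth_piece minx0 (polyP i) (psdA i) (RE i) (unit_neq0 u1) Pu).
apply: filterS => e H x xu t t0 te Px.
have [i _ Pi] : (\bigcup_i P i) (x0 + t *: x) by rewrite covP.
exact: H Pi.
Qed.

(** For a minimizer [x0 + t w] of [R] on its fibre the conclusion says that its
    distance [t] to [x0] is at most [e^-1] times the norm of [Phi (t w)]: an
    error bound that is linear in the perturbation of the constraint. *)
Lemma fibre_min_lipschitz : convex_plq ipX R ->
  \forall e \near 0^'+, forall w, N w = 1 -> forall t, 0 < t -> t <= e ->
    (forall z, Phi z = Phi (x0 + t *: w) -> R (x0 + t *: w) <= R z) ->
    e <= NY (Phi w).
Proof.
move=> [_ [k [P [A [b [c [polyP covP psdA RE]]]]]]].
apply: sphere_uniform => [e e' x e0 ee' H t t0 te minx|u u1].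
  by rewrite (le_trans ee')// (H t)// (le_trans te).
have [Pu|Pu] := eqVneq (Phi u) 0; last first.
  by apply: filterS (enorm_near_ge ipX ipY Pu) => e H x /H.
have : \forall e \near 0^'+, forall i x t, N (x - u) <= e -> 0 < t -> t <= e ->
    P i (x0 + t *: x) ->
    ~ (forall z, Phi z = Phi (x0 + t *: x) -> R (x0 + t *: x) <= R z).
  apply: filter_forall => i.
  exact: (fibre_min_piece minx0 (polyP i) (psdA i) (RE i) (unit_neq0 u1) Pu).
apply: filterS => e H x xu t t0 te minx.
have [i _ Pi] : (\bigcup_i P i) (x0 + t *: x) by rewrite covP.
by case: (H _ _ _ xu t0 te Pi).
Qed.

(** On the sphere of radius [r] around [x0] no point can almost satisfy the
    constraint and have almost the optimal value, by strict minimality and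
    compactness. A point farther away would produce one, by convexity, on the
    segment joining it to [x0]. *)
Lemma near_optimal_near r : jensen R -> econtinuous ipX R -> 0 < r ->
  exists2 e : K, 0 < e & forall x, R x - R x0 < e -> NY (Phi (x - x0)) < e ->
    N (x - x0) < r.
Proof.
move=> cR ctR r0.
pose Q e w := e <= R (x0 + r *: w) - R x0 \/ e <= NY (Phi w).
have : \forall e \near 0^'+, forall w, N w = 1 -> Q e w.
  apply: sphere_uniform => [e e' x e0 ee' [] H|u u1].
  - by left; exact: le_trans H.
  - by right; exact: le_trans H.
  have [Pu|Pu] := eqVneq (Phi u) 0; last first.
    by apply: filterS (enorm_near_ge ipX ipY Pu) => e H x /H; right.
  have gap : 0 < (R (x0 + r *: u) - R x0) / 2.
    rewrite divr_gt0// subr_gt0 minx0//; first by rewrite linearZ /= Pu scaler0.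
    by rewrite scaler_eq0 negb_or unit_neq0// gt_eqF.
  have [d d0 Hd] := ctR (x0 + r *: u) _ gap.
  near=> e => x xu; left.
  have eg : e <= (R (x0 + r *: u) - R x0) / 2 by near: e; exact: nbhs_right_le.
  have /Hd : N (x0 + r *: x - (x0 + r *: u)) < d.
    rewrite opprD addrACA subrr add0r -scalerBr enormZ gtr0_norm//.
    rewrite mulrC -ltr_pdivlMr// (le_lt_trans xu)//; near: e.
    by apply: nbhs_right_lt; rewrite divr_gt0.
  rewrite ltr_norml; lra.
move=> /filterI /(_ (nbhs_right_gt 0)) /filter_ex[e [H e0]].
exists (Num.min e (e * r)); first by rewrite lt_min e0 mulr_gt0.
move=> x; rewrite !lt_min => /andP[Rx _] /andP[_ Px].
have [->|/polar[w [t [w1 t0 tE xE]]]] := eqVneq x x0.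
  by rewrite subrr enorm0.
rewrite -tE ltNge; apply/negP => rt; have [] := H w w1; last first.
  apply/negP; rewrite -ltNge -(ltr_pM2r t0); apply: lt_le_trans (_ : e * r <= _).
    by move: Px; rewrite {1}xE [x0 + _]addrC addrK linearZ enormZ gtr0_norm// mulrC.
  by rewrite ler_pM2l.
apply/negP; rewrite -ltNge.
have s0 : 0 <= r / t by rewrite divr_ge0 ?ltW.
have s1 : r / t <= 1 by rewrite ler_pdivrMr// mul1r.
have := cR (r / t) x x0 s0 s1.
have -> : (r / t) *: x + (1 - r / t) *: x0 = x0 + r *: w.
  rewrite xE scalerDr addrAC -scalerDl [r / t + _]addrC subrK scale1r scalerA.
  by rewrite divfK ?gt_eqF.
have : r / t * (R x - R x0) < e.
  have [Rx0|Rx0] := leP (R x - R x0) 0.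
    by rewrite (le_lt_trans _ e0)// mulr_ge0_le0.
  by rewrite (le_lt_trans _ Rx)// ger_pMl.
lra.
Unshelve. all: by end_near. Qed.

End Recover.

(** * The equivalences *)

Section Final.
Context (K : realType) (X Y : vectType K).
Context (ipX : {dot X for idfun}) (ipY : {dot Y for idfun}).
Context (Phi : 'Hom(X, Y)) (R : X -> K).
Local Notation N := (enorm ipX).
Local Notation NY := (enorm ipY).

Lemma unique_strong (y0 : Y) (x0 : X) : convex_plq ipX R ->
  unique_optimal_solution Phi R y0 x0 ->
  strong_optimal_solution ipX Phi R y0 x0.
Proof.
move=> plqR ux0; have [[Px0 _] _] := ux0; split=> //.
have := quadratic_growth ipY (unique_strict_min ux0) plqR.
move=> /filterI /(_ (nbhs_right_gt 0)) /filter_ex[e [H e0]].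
exists (2 * e), e; split=> //; first by rewrite mulr_gt0.
move=> x Px; have [->|/(polar ipX)[w [t [w1 t0 tE xE]]]] := eqVneq x x0.
  by rewrite !subrr enorm0 expr0n mulr0.
rewrite -tE => te; rewrite [2 * e]mulrC mulfK// xE; apply: H => //.
have : Phi (t *: w) = 0.
  by rewrite -[t *: w](addKr x0) -xE addrC linearB /= Px Px0 subrr.
by rewrite linearZ => /eqP; rewrite scaler_eq0 gt_eqF//= => /eqP.
Qed.

(** A regularized solution [x] satisfies
    [|Phi x - y|^2 + 2 c d (R x - R x0) <= d^2]. The multiplier bounds
    [R x - R x0] below by [- |v| (|Phi x - y| + d)], whence a quadratic
    inequality giving [|Phi x - y| <= (1 + 2 c |v|) d]; dropping the square
    instead bounds [R x - R x0] above by [d / (2 c)]. For small [d] this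
    brings [x] into the neighbourhood of [x0] where [fibre_min_lipschitz]
    applies. *)
Lemma unique_stable (y0 : Y) (x0 : X) : econtinuous ipX R ->
  convex_plq ipX R -> unique_optimal_solution Phi R y0 x0 ->
  stable_recovery ipX ipY Phi R y0 x0.
Proof.
move=> ctR plqR ux0 c c0; have minx0 := unique_strict_min ux0.
have cR := convex_functionE (proj1 plqR); have [[Px0 optx0] _] := ux0.
have [v Hv] := optimal_multiplier ipY cR (proj1 ux0).
have := fibre_min_lipschitz ipY minx0 plqR.
move=> /filterI /(_ (nbhs_right_gt 0)) /filter_ex[r [Hr r0]].
have [e e0 He] := near_optimal_near ipY minx0 cR ctR r0.
have V0 := enorm_ge0 ipY v.
pose C := 2 + 2 * c * NY v.
have cV : 0 <= c * NY v by rewrite mulr_ge0// ltW.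
have C0 : 0 < C by rewrite /C; lra.
exists (C / r), (Num.min (e / C) (2 * c * e)).
split; [exact: divr_gt0 | by rewrite lt_min divr_gt0// !mulr_gt0 |].
move=> d y x d0; rewrite lt_min ltr_pdivlMr// => /andP[dC dc] yd solx.
have cd : 0 < c * d by rewrite mulr_gt0.
have dE : Phi (x - x0) = Phi x - y0 by rewrite linearB /= Px0.
have tri : NY (Phi x - y0) <= NY (Phi x - y) + d.
  by rewrite -(subrKA y) (le_trans (enormD _ _ _))// lerD2l.
have le_R : - (NY v * NY (Phi x - y0)) <= R x - R x0.
  by have := Hv x; have := normr_ip_le ipY v (Phi x - y0); rewrite ler_norml; lra.
have le_obj : NY (Phi x - y) ^+ 2 + 2 * (c * d) * (R x - R x0) <= d ^+ 2.
  have := solx x0; rewrite /regularized_objective Px0.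
  have : NY (y0 - y) ^+ 2 <= d ^+ 2.
    by rewrite enormBC ler_pXn2r// nnegrE ?enorm_ge0// ltW.
  lra.
have res0 := enorm_ge0 ipY (Phi x - y).
have res_le : NY (Phi x - y) <= (1 + 2 * c * NY v) * d.
  have : 2 * (c * d) * - (NY v * (NY (Phi x - y) + d)) <=
         2 * (c * d) * (R x - R x0).
    rewrite ler_pM2l ?mulr_gt0//; apply: le_trans le_R.
    by rewrite lerN2 ler_wpM2l.
  have dr0 : 0 < d + NY (Phi x - y) by lra.
  (* After multiplication by [d + |Phi x - y|], the claim is the quadratic
     inequality in factored form. *)
  move=> le_res; rewrite -subr_le0 -(pmulr_lle0 _ dr0); lra.
have fib_le : NY (Phi (x - x0)) <= C * d by rewrite dE /C; lra.
have val_le : R x - R x0 <= d / (2 * c).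
  rewrite ler_pdivlMr ?mulr_gt0// -(ler_pM2r d0).
  have := sqr_ge0 (NY (Phi x - y)); lra.
have xr : N (x - x0) < r.
  apply: He; last by rewrite (le_lt_trans fib_le)// mulrC.
  by rewrite (le_lt_trans val_le)// ltr_pdivrMr ?mulr_gt0// mulrC.
have [xx0|/(polar ipX)[w [t [w1 t0 tE xE]]]] := eqVneq x x0.
  by rewrite xx0 subrr enorm0 ltW// mulr_gt0// divr_gt0.
rewrite -tE mulrAC ler_pdivlMr//; apply: le_trans fib_le.
have -> : NY (Phi (x - x0)) = t * NY (Phi w).
  by rewrite {1}xE [x0 + _]addrC addrK linearZ enormZ gtr0_norm.
rewrite ler_pM2l//; apply: (Hr w w1 t t0); first by rewrite tE ltW.
(* On a fibre the two objectives differ by a constant and a positive factor. *)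
rewrite -xE => z Pz; have := solx z.
by rewrite /regularized_objective Pz lerD2l ler_pM2l.
Qed.

End Final.

Theorem corollary3p8 (K : realType) (X Y : vectType K)
    (ipX : {dot X for idfun}) (ipY : {dot Y for idfun})
    (Phi : 'Hom(X, Y)) (y0 : Y) (R : X -> K) (x0 : X)
    (contR : econtinuous ipX R) (plqR : convex_plq ipX R)
    (solx0 : optimal_solution Phi R y0 x0) :
  (stable_recovery ipX ipY Phi R y0 x0 <->
     unique_optimal_solution Phi R y0 x0) /\
  (unique_optimal_solution Phi R y0 x0 <->
     strong_optimal_solution ipX Phi R y0 x0).
Proof.
have cR := convex_functionE (proj1 plqR).
split; split.
- exact: stable_unique.
- exact: unique_stable.
- exact: unique_strong.
- exact: strong_unique.
Qed.
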